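(* Let $K$ be a commutative field of characteristic $\neq 2$. For all integers $p,q\ge1$ put $$E_{p,q}(x)=x^px^q-x^{p+1}-x^{q+1}+x^2 .$$ Let $\mathscr E$ be the ideal generated by the family $\{E_{p,q} : p,q\ge1\}$ and let $\pi:K(x)\to K(x)/\mathscr E$ be the canonical surjection. Then for every $n\ge4$ and every $w\in\mathfrak M(x)_{[n]}$ with $w\ne x^n$ one has $\pi(w)=P_w$, and for every $f\in K(x)$ of degree $\ge4$ the polynomial $f-\pi(f)$ is an evanescent train identity. Here, for $w\in\mathfrak M(x)_{[n]}$ with $n\ge 4$ and $w\neq x^n$, $P_w$ denotes the unique polynomial of $\mathbb Q\langle x\rangle$ of degree $<n$ such that $w-P_w$ is an evanescent train identity.
   Context: $\mathfrak M(x)$ is the set of commutative nonassociative monomials in one letter $x$ (free commutative magma), $\mathfrak M(x)_{[n]}$ is the set of those of degree $n$ (the degree is the number of letters), and $K(x)$ is the free commutative nonassociative $K$-algebra with basis $\mathfrak M(x)$; the degree of a polynomial is the maximal degree of its monomials. $K$ is assumed to satisfy $\operatorname{card}K^*>|f|_x$ for the polynomials $f$ considered, where $|f|_x$ is the degree of $f$ in $x$. Principal powers: $x^1=x$, $x^{k+1}=x\,x^k$. $\mathbb Q\langle x\rangle$ is the $\mathbb Q$-vector space spanned by $\{x^k : k\ge1\}$. In the expressions $\pi(w)=P_w$ and $f-\pi(f)$, the class $\pi(f)$ is written as a linear combination of the principal powers $x^k$, obtained by reducing $f$ modulo the $E_{p,q}$. $\partial_x:K(x)\to K[t]$ is the linear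 map with $\partial_x(x)=1$ and $\partial_x(uv)=t(\partial_xu+\partial_xv)$ for monomials $u,v$. A polynomial $f$ is an evanescent identity if $f\neq0$, $\partial_xf=0$ and $f(1)=0$, where $f(1)$ is the sum of the coefficients of $f$. A train polynomial of degree $(n)$ is a non-homogeneous polynomial $f=g-\sum_{i=1}^rh_i$ with $f(1)=0$, $g$ homogeneous of degree $n$, and each $h_i$ homogeneous of degree $\delta_i$, where $0\le\delta_1<\dots<\delta_r<n$. An evanescent train identity is a train polynomial that is an evanescent identity.
   Formalization: The last clause fails for f in K<x> (f − π(f) = 0) and when f − π(f) is homogeneous, e.g. f = x²(x²x²) − x³x³; it is stated as: f − π(f) is an evanescent identity if f is not in K<x>, and an evanescent train identity if f − π(f) is not homogeneous. *)

(* Defs.v *)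
From HB Require Import structures.
From mathcomp Require Import all_boot all_order all_algebra.
From mathcomp Require Import generic_quotient ring_quotient archimedean.
From mathcomp Require Import finmap monalg boolp.

Set Implicit Arguments.
Unset Strict Implicit.
Unset Printing Implicit Defensive.

Import Order.TTheory GRing.Theory Num.Theory.
Local Open Scope ring_scope.
Local Open Scope quotient_scope.

(* The free commutative magma on one letter x: binary trees (the free magma) *)
(* modulo the congruence generated by commutativity, decided by [teq]. *)

Inductive tree := Leaf | Node of tree & tree.

Fixpoint tree_code (t : tree) : GenTree.tree unit :=
  if t is Node a b then GenTree.Node 0 [:: tree_code a; tree_code b]
  else GenTree.Leaf tt.

Fixpoint tree_decode (c : GenTree.tree unit) : option tree :=
  match c with
  | GenTree.Leaf _ => Some Leaf
  | GenTree.Node _ [:: a; b] =>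
      if (tree_decode a, tree_decode b) is (Some a', Some b')
      then Some (Node a' b') else None
  | _ => None
  end.

Lemma tree_codeK : pcancel tree_code tree_decode.
Proof. by elim=> [|a IHa b IHb] //=; rewrite IHa IHb. Qed.

HB.instance Definition _ := Countable.copy tree (pcan_type tree_codeK).

Fixpoint teq (t u : tree) : bool :=
  match t, u with
  | Leaf, Leaf => true
  | Node a b, Node c d => (teq a c && teq b d) || (teq a d && teq b c)
  | _, _ => false
  end.

Lemma teq_refl : reflexive teq.
Proof. by elim=> [|a IHa b IHb] //=; rewrite IHa IHb. Qed.

Lemma teq_sym : symmetric teq.
Proof.
elim=> [|a IHa b IHb] [|c d] //=.
by rewrite (IHa c) (IHb d) (IHa d) (IHb c) [teq d a && _]andbC.
Qed.

Lemma teq_trans : transitive teq.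
Proof.
move=> u t; elim: t u => [|a IHa b IHb] [|c d] [|e f] //=.
case/orP=> /andP[h1 h2]; case/orP=> /andP[h3 h4].
- by rewrite (IHa _ _ h1 h3) (IHb _ _ h2 h4).
- by rewrite (IHa _ _ h1 h3) (IHb _ _ h2 h4) orbT.
- by rewrite (IHa _ _ h1 h4) (IHb _ _ h2 h3) orbT.
- by rewrite (IHa _ _ h1 h4) (IHb _ _ h2 h3).
Qed.

Canonical teq_equiv := EquivRel teq teq_refl teq_sym teq_trans.

Definition cmon := {eq_quot teq}.
HB.instance Definition _ := Choice.on cmon.
HB.instance Definition _ := EqQuotient.on cmon.

Definition cx : cmon := \pi_cmon Leaf.
Definition cmul (u v : cmon) : cmon := \pi_cmon (Node (repr u) (repr v)).

Fixpoint tfold (T : Type) (a : T) (op : T -> T -> T) (t : tree) : T :=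
  if t is Node u v then op (tfold a op u) (tfold a op v) else a.

(* When [op] is commutative, [cfold a op] is the morphism of magmas from *)
(* [cmon] to (T, op) that maps x to a; see [cfold_x] and [cfoldM]. *)
Definition cfold (T : Type) (a : T) (op : T -> T -> T) (m : cmon) : T :=
  tfold a op (repr m).

Lemma cmulC : commutative cmul.
Proof.
by move=> u v; apply/eqP; rewrite eqmodE /= !teq_refl orbT.
Qed.

Section Fold.
Variables (T : Type) (a : T) (op : T -> T -> T).
Hypothesis opC : commutative op.

Lemma tfold_teq t u : teq t u -> tfold a op t = tfold a op u.
Proof.
elim: t u => [|b IHb c IHc] [|d e] //=.
by case/orP=> /andP[/IHb-> /IHc->] //; rewrite opC.
Qed.

Lemma cfold_pi t : cfold a op (\pi_cmon t) = tfold a op t.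
Proof. by apply: tfold_teq; rewrite -eqmodE reprK. Qed.

Lemma cfold_x : cfold a op cx = a.
Proof. by rewrite cfold_pi. Qed.

Lemma cfoldM u v : cfold a op (cmul u v) = op (cfold a op u) (cfold a op v).
Proof. by rewrite cfold_pi. Qed.
End Fold.

Definition cdeg : cmon -> nat := cfold 1%N addn.

(* Principal power x^k, for k >= 1; the value at k = 0 is junk. *)
Definition ppow (k : nat) : cmon := iter k.-1 (cmul cx) cx.

(* K(x): the K-module with basis [cmon], with the bilinear product [kmul]. *)
Definition KX (K : fieldType) := {malg K[cmon]}.
HB.instance Definition _ (K : fieldType) := GRing.Lmodule.on (KX K).

Section Algebra.
Variable K : fieldType.
Implicit Types f g h : KX K.

Definition mono (m : cmon) : KX K := << 1 *g m >>.

Definition kmul f g : KX K :=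
  \sum_(u <- msupp f) \sum_(v <- msupp g) << f@_u * g@_v *g cmul u v >>.

(* The degree of 0 is 0 by convention. *)
Definition kdeg f : nat := \max_(m <- msupp f) cdeg m.

Definition eval1 f : K := \sum_(m <- msupp f) f@_m.

Definition dmon : cmon -> {poly K} := cfold 1 (fun p q => 'X * (p + q)).

Definition partial f : {poly K} := \sum_(m <- msupp f) f@_m *: dmon m.

Lemma dmon_x : dmon cx = 1.
Proof. by apply: cfold_x => p q; rewrite addrC. Qed.

Lemma dmonM u v : dmon (cmul u v) = 'X * (dmon u + dmon v).
Proof. by apply: cfoldM => p q; rewrite addrC. Qed.

(* 0 is homogeneous of every degree. *)
Definition homog (d : nat) f : bool := all (fun m => cdeg m == d) (msupp f).

Definition homogeneous f : Prop := exists d, homog d f.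

Definition evanescent f : Prop := [/\ f <> 0, partial f = 0 & eval1 f = 0].

Definition train_poly (n : nat) f : Prop :=
  [/\ ~ homogeneous f, eval1 f = 0 &
   exists (g : KX K) (r : nat) (h : 'I_r -> KX K) (delta : 'I_r -> nat),
    [/\ f = g - \sum_i h i,
        g <> 0 /\ homog n g,
        forall i, h i <> 0 /\ homog (delta i) (h i),
        forall i j : 'I_r, (i < j)%N -> (delta i < delta j)%N &
        forall i, (delta i < n)%N]].

Definition evanescent_train f : Prop :=
  (exists n, train_poly n f) /\ evanescent f.

(* K<x>, the K-span of the principal powers x^k, k >= 1. *)
Definition principal_span f : Prop :=
  exists c : seq K, f = \sum_(i < size c) c`_i *: mono (ppow i.+1).

Definition Epq (p q : nat) : KX K :=
  kmul (mono (ppow p)) (mono (ppow q))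
  - mono (ppow p.+1) - mono (ppow q.+1) + mono (ppow 2).

(* Ideal of the nonunital algebra K(x) generated by the Epq p q, p, q >= 1. *)
Inductive in_ideal : KX K -> Prop :=
  | ideal_gen p q : (0 < p)%N -> (0 < q)%N -> in_ideal (Epq p q)
  | ideal_zero : in_ideal 0
  | ideal_add f g : in_ideal f -> in_ideal g -> in_ideal (f + g)
  | ideal_scale (c : K) f : in_ideal f -> in_ideal (c *: f)
  | ideal_mull f g : in_ideal g -> in_ideal (kmul f g)
  | ideal_mulr f g : in_ideal f -> in_ideal (kmul f g).

Definition idealE : {pred KX K} := fun f => `[< in_ideal f >].

Lemma idealE_zmod_closed : zmod_closed idealE.
Proof.
split=> [|f g]; rewrite /in_mem /=; first by apply/asboolP/ideal_zero.
move=> /asboolP fE /asboolP gE; apply/asboolP/ideal_add => //.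
by rewrite -scaleN1r; apply: ideal_scale.
Qed.

HB.instance Definition _ :=
  GRing.isZmodClosed.Build (KX K) idealE idealE_zmod_closed.

(* K(x) / E; only its additive structure is needed to compare classes. *)
Definition quotE := Quotient.quot (idealE : zmodClosed (KX K)).

Definition projE f : quotE := \pi_quotE f.

(* [reduces_to f r]: r is the class of f modulo E written as a linear *)
(* combination of principal powers. *)
Definition reduces_to f r : Prop := principal_span r /\ projE f = projE r.

(* The property that characterizes P_w, w a monomial of degree n. *)
Definition train_reduct (n : nat) (w : cmon) (P : KX K) : Prop :=
  [/\ principal_span P, (kdeg P < n)%N & evanescent_train (mono w - P)].

End Algebra.

(* card K^* > n, for a possibly infinite field K. *)
Definition card_units_gt (K : fieldType) (n : nat) : Prop :=
  exists s : seq K, [/\ uniq s, 0 \notin s & (n < size s)%N].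

(* Change of coefficients from Q to K. [ratr] is only well behaved in *)
(* positive characteristic on denominators prime to it, e.g. on integers. *)
Definition base_change (K : fieldType) (P : KX rat) : KX K :=
  \sum_(m <- msupp P) << ratr P@_m *g m >>.

(* Main.v *)
(* Modulo E, the product of two combinations u, v of principal powers with
   coefficient sum 1 is S u + S v - x^2, where S shifts exponents by one. Hence
   every monomial w is congruent to an integral combination P_w of principal
   powers, whose degree is at most the depth of the tree w plus one: it is < n
   unless w = x^n. The common kernel of the derivation-like map partial and of
   the evaluation at 1 is an ideal containing every E_{p,q}, so w - P_w is
   evanescent. Uniqueness holds because partial x^k has degree k - 1 with
   leading coefficient 1 or 2, so partial is injective on the span of the
   principal powers. *)
Require Import Defs.
From mathcomp Require Import all_boot all_order all_algebra.
From mathcomp Require Import archimedean finmap monalg.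
From HB Require Import structures.
From mathcomp Require Import generic_quotient ring_quotient boolp.
From mathcomp Require Import zify ring.

Set Implicit Arguments.
Unset Strict Implicit.
Unset Printing Implicit Defensive.

Import GRing.Theory Num.Theory.
Local Open Scope ring_scope.

Lemma ppowS n : (0 < n)%N -> ppow n.+1 = cmul cx (ppow n).
Proof. by case: n. Qed.

(** * Linear maps on K(x) prescribed on monomials *)

Section LinearExtension.
Variables (K : fieldType) (V : lmodType K).
Implicit Types (phi : cmon -> V) (f g : KX K).

Definition lext phi f : V := \sum_(m <- msupp f) f@_m *: phi m.

Lemma lextEw phi (A : {fset cmon}) f : (msupp f `<=` A)%fset ->
  lext phi f = \sum_(m <- A) f@_m *: phi m.
Proof.
move=> sfA; rewrite /lext; apply: big_fset_incl => // m _ /mcoeff_outdom->.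
by rewrite scale0r.
Qed.

Lemma lext_is_linear phi : linear (lext phi).
Proof.
(* The three sums run over different supports; a common finite superset makes them comparable
   termwise. *)
move=> c f g; pose A := (msupp (c *: f + g)%R `|` (msupp f `|` msupp g))%fset.
have sA : [/\ msupp (c *: f + g)%R `<=` A, msupp f `<=` A & msupp g `<=` A]%fset.
  by split; apply/fsubsetP => m mf; rewrite !in_fsetU mf ?orbT.
case: sA => s1 s2 s3; rewrite (lextEw _ s1) (lextEw _ s2) (lextEw _ s3).
rewrite scaler_sumr -big_split; apply: eq_bigr => m _.
by rewrite mcoeffD mcoeffZ scalerDl scalerA.
Qed.
HB.instance Definition _ phi :=
  GRing.isLinear.Build K (KX K) V _ (lext phi) (lext_is_linear phi).

Lemma lext_mono phi m : lext phi (mono K m) = phi m.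
Proof.
by rewrite /lext /mono msuppU oner_eq0 big_seq_fset1 mcoeffUU scale1r.
Qed.
End LinearExtension.

(** * Product, evaluation at 1 and [partial]; their behaviour on the ideal *)

Section Algebra.
Variable K : fieldType.
Implicit Types (f g h : KX K).

Lemma malgU_mono (c : K) m : << c *g m >> = c *: mono K m.
Proof. by apply/malgP => u; rewrite mcoeffZ !mcoeffU mulr_natr. Qed.

Lemma lext_id f : lext (@mono K) f = f.
Proof.
rewrite [RHS]monalgE; apply: eq_bigr => m _.
by rewrite malgU_mono.
Qed.

Lemma eval1E f : eval1 f = lext (fun=> 1 : K^o) f.
Proof. by apply: eq_bigr => m _; rewrite -[RHS]/(_ * 1) mulr1. Qed.

Lemma eval1_is_linear : linear_for *%R (@eval1 K).
Proof. by move=> c f g; rewrite !eval1E linearP. Qed.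
HB.instance Definition _ :=
  GRing.isLinear.Build K (KX K) K _ (@eval1 K) eval1_is_linear.

Lemma eval1_mono m : eval1 (mono K m) = 1.
Proof. by rewrite eval1E lext_mono. Qed.

Lemma partialE f : partial f = lext (dmon K) f.
Proof. by []. Qed.

Lemma partial_is_linear : linear (@partial K).
Proof. by move=> c f g; rewrite !partialE linearP. Qed.
HB.instance Definition _ :=
  GRing.isLinear.Build K (KX K) {poly K} _ (@partial K) partial_is_linear.

Lemma partial_mono m : partial (mono K m) = dmon K m.
Proof. by rewrite partialE lext_mono. Qed.

Lemma kmulE f g :
  kmul f g = lext (fun u => lext (fun v => mono K (cmul u v)) g) f.
Proof.
apply: eq_bigr => u _; rewrite scaler_sumr; apply: eq_bigr => v _.
by rewrite malgU_mono scalerA.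
Qed.

Lemma kmulC f g : kmul f g = kmul g f.
Proof.
rewrite /kmul exchange_big; apply: eq_bigr => v _; apply: eq_bigr => u _.
by rewrite mulrC cmulC.
Qed.

Lemma kmulr_is_linear f : linear (kmul f).
Proof. by move=> c g g'; rewrite !(kmulC f) !kmulE linearP. Qed.
HB.instance Definition _ f :=
  GRing.isLinear.Build K (KX K) (KX K) _ (kmul f) (kmulr_is_linear f).

Lemma kmul_mono u v : kmul (mono K u) (mono K v) = mono K (cmul u v).
Proof. by rewrite kmulE !lext_mono. Qed.

Lemma eval1M f g : eval1 (kmul f g) = eval1 f * eval1 g.
Proof.
rewrite /kmul raddf_sum /eval1 mulr_suml; apply: eq_bigr => u _.
rewrite raddf_sum mulr_sumr; apply: eq_bigr => v _ /=.
by rewrite malgU_mono linearZ /= eval1_mono mulr1.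
Qed.

(** On monomials this is the recursion of [dmon]; the weights [eval1 g] and [eval1 f], both 1 there,
    make the right side bilinear. *)
Lemma partialM f g :
  partial (kmul f g) = 'X * (eval1 g *: partial f + eval1 f *: partial g).
Proof.
have -> : eval1 f *: partial g = \sum_(u <- msupp f) f@_u *: partial g.
  by rewrite scaler_suml.
have -> : eval1 g *: partial f =
    \sum_(u <- msupp f) eval1 g *: (f@_u *: dmon K u) by rewrite -scaler_sumr.
rewrite -big_split mulr_sumr /kmul raddf_sum; apply: eq_bigr => u _ /=.
rewrite [eval1 g]/eval1 [partial g]/partial scaler_suml scaler_sumr -big_split.
rewrite mulr_sumr raddf_sum; apply: eq_bigr => v _ /=.
rewrite malgU_mono linearZ /= partial_mono dmonM scalerAr scalerDr !scalerA.
by rewrite [g@_v * _]mulrC.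
Qed.

(** By [partialM], killing a product under [partial] needs both the value at 1 and the [partial] of
    a factor to vanish, so the two conditions are carried through the induction together. On
    generators, t(a + b) - t(1 + a) - t(1 + b) + 2t = 0. *)
Lemma partial_eval1_ideal f : in_ideal f -> partial f = 0 /\ eval1 f = 0.
Proof.
elim=> {f} [p q p0 q0||f g _ [f1 f2] _ [g1 g2]|c f _ [f1 f2]|f g _ [g1 g2]
  |f g _ [f1 f2]].
- rewrite /Epq !raddfD !raddfN /= partialM eval1M !partial_mono !eval1_mono.
  rewrite (ppowS p0) (ppowS q0) (@ppowS 1) // -[ppow 1]/cx !dmonM !dmon_x
    !scale1r mulr1 subrr add0r addNr.
  by split=> //; ring.
- by rewrite !raddf0.
- by rewrite !raddfD /= f1 f2 g1 g2 !addr0.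
- by rewrite !linearZ /= f1 f2 scaler0 mulr0.
- by rewrite partialM eval1M g1 g2 scale0r scaler0 addr0 !mulr0.
- by rewrite partialM eval1M f1 f2 scale0r scaler0 addr0 mulr0 mul0r.
Qed.
End Algebra.

(** * Combinations of principal powers encoded as polynomials, and their products modulo the
    ideal *)

Section PrincipalSpan.
Variable K : fieldType.
Implicit Types (f g h : KX K) (p q : {poly K}) (c : K).

(* The exponent is shifted: 'X^i stands for the principal power x^(i+1). *)
Definition ppoly p : KX K := \sum_(i < size p) p`_i *: mono K (ppow i.+1).

Lemma ppolyEw n p : (size p <= n)%N ->
  ppoly p = \sum_(i < n) p`_i *: mono K (ppow i.+1).
Proof.
move=> le_pn; rewrite /ppoly.
rewrite (big_ord_widen n (fun i => p`_i *: mono K (ppow i.+1))) // big_mkcond.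
apply: eq_bigr => i _; case: ltnP => // /(nth_default 0)->.
by rewrite scale0r.
Qed.

Lemma ppoly_is_linear : linear ppoly.
Proof.
move=> c p q; pose r : {poly K} := c *: p + q.
pose n := maxn (size r) (maxn (size p) (size q)).
rewrite !(@ppolyEw n) ?leq_max ?leqnn ?orbT // scaler_sumr -big_split.
by apply: eq_bigr => i _; rewrite coefD coefZ scalerDl scalerA.
Qed.
HB.instance Definition _ :=
  GRing.isLinear.Build K {poly K} (KX K) _ ppoly ppoly_is_linear.

Lemma ppolyX : ppoly 'X = mono K (ppow 2).
Proof.
rewrite (@ppolyEw 2) ?size_polyX // 2!big_ord_recl big_ord0 !coefX /=.
by rewrite scale0r scale1r add0r addr0.
Qed.

Lemma ppoly1 : ppoly 1 = mono K cx.
Proof. by rewrite (@ppolyEw 1) ?size_poly1 // big_ord1 coef1 scale1r. Qed.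

Lemma ppoly_mulX p :
  ppoly ('X * p) = \sum_(i < size p) p`_i *: mono K (ppow i.+2).
Proof.
rewrite (@ppolyEw (size p).+1); last first.
  by rewrite (leq_trans (size_polyMleq _ _)) // size_polyX.
rewrite big_ord_recl coefXM scale0r add0r.
by apply: eq_bigr => i _; rewrite coefXM.
Qed.

Lemma principal_spanP f : principal_span f <-> exists p, f = ppoly p.
Proof.
split=> [[s ->]|[p ->]]; last by exists p.
exists (Poly s); rewrite (@ppolyEw (size s)) ?size_Poly //.
by apply: eq_bigr => i _; rewrite coef_Poly.
Qed.

Lemma eval1_ppoly p : eval1 (ppoly p) = p.[1].
Proof.
rewrite raddf_sum horner_coef; apply: eq_bigr => i _ /=.
by rewrite linearZ /= eval1_mono expr1n.
Qed.

Lemma in_ideal_sum (I : Type) (r : seq I) (c : I -> K) (F : I -> KX K) :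
  (forall i, in_ideal (F i)) -> in_ideal (\sum_(i <- r) c i *: F i).
Proof.
move=> FE; apply: big_ind => [||i _]; first exact: ideal_zero.
  exact: ideal_add.
exact: ideal_scale.
Qed.

(* Expanding both factors expresses the difference as a combination of the
   E_{i+1,j+1}; the normalisations keep the correction terms linear. *)
Lemma in_ideal_kmul_ppoly p q : p.[1] = 1 -> q.[1] = 1 ->
  in_ideal (kmul (ppoly p) (ppoly q) - ppoly ('X * (p + q - 1))).
Proof.
move=> p1 q1.
have step (i : nat) : in_ideal (kmul (mono K (ppow i.+1)) (ppoly q)
    - (mono K (ppow i.+2) + ppoly ('X * q) - ppoly 'X)).
  suff -> : kmul (mono K (ppow i.+1)) (ppoly q)
      - (mono K (ppow i.+2) + ppoly ('X * q) - ppoly 'X)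
      = \sum_(j < size q) q`_j *: Epq K i.+1 j.+1.
    by apply: in_ideal_sum => j; apply: ideal_gen.
  rewrite raddf_sum ppoly_mulX ppolyX.
  (* Since q(1) = 1, a term independent of j equals its q-weighted sum and can be absorbed into the
     sum over j. *)
  have sq (a : KX K) : a = \sum_(j < size q) q`_j *: a.
    rewrite -scaler_suml; suff -> : \sum_(j < size q) q`_j = 1 by rewrite scale1r.
    rewrite -q1 horner_coef; apply: eq_bigr => j _.
    by rewrite expr1n mulr1.
  rewrite [mono K (ppow i.+2) in LHS]sq [mono K (ppow 2) in LHS]sq.
  rewrite -big_split -!sumrB; apply: eq_bigr => j _ /=.
  by rewrite linearZ /= /Epq !scalerDr !scalerN !opprD opprK !addrA.
suff -> : kmul (ppoly p) (ppoly q) - ppoly ('X * (p + q - 1)) =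
    \sum_(i < size p) p`_i *: (kmul (mono K (ppow i.+1)) (ppoly q)
       - (mono K (ppow i.+2) + ppoly ('X * q) - ppoly 'X)).
  by apply: in_ideal_sum => i; apply: step.
have sp (a : KX K) : \sum_(i < size p) p`_i *: a = a.
  rewrite -scaler_suml; suff -> : \sum_(i < size p) p`_i = 1 by rewrite scale1r.
  rewrite -p1 horner_coef; apply: eq_bigr => j _.
  by rewrite expr1n mulr1.
under [RHS]eq_bigr do rewrite -addrA scalerBr scalerDr.
rewrite sumrB big_split /= sp -ppoly_mulX kmulC raddf_sum; congr (_ - _).
  by apply: eq_bigr => i _ /=; rewrite linearZ /= kmulC.
by rewrite -raddfB -raddfD /= -addrA mulrDr mulrBr mulr1.
Qed.
End PrincipalSpan.

(** * Injectivity of [partial] on the principal span *)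

Section Injectivity.
Variable K : fieldType.
Implicit Types p q : {poly K}.

(** The recursion is d -> t(1 + d), starting at 1: the first step gives 2t, and every later one
    shifts the leading coefficient 2 and adds only t, of lower degree. *)
Lemma coef_dmon_ppow i j : (i <= j)%N ->
  (dmon K (ppow i.+1))`_j = if j == i then (if i == 0 then 1 else 2%:R) else 0.
Proof.
elim: i j => [|i IHi] [|j] // le_ij; rewrite /= ?dmon_x ?coef1 //.
rewrite dmonM dmon_x coefXM coefD coef1 /= IHi // eqSS.
by case: j i le_ij {IHi} => [|j] [|i] //= _; rewrite ?add0r ?addr0.
Qed.

Lemma partial_ppoly_inj : 2%N \notin [pchar K] ->
  injective (fun p => partial (ppoly p)).
Proof.
move=> char2 p q /= pq; apply/eqP; rewrite -subr_eq0.
have {pq} : partial (ppoly (p - q)) = 0 by rewrite !raddfB /= pq subrr.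
move: {p q}(p - q) => p /polyP p0.
apply/negPn/negP => nzp; have := nzp; rewrite -size_poly_gt0.
case def_n: (size p) => [//|n] _.
move: (p0 n); rewrite coef0.
(* Triangularity: only the top principal power contributes in degree n, with coefficient 1 or 2,
   which is nonzero in K. *)
rewrite /ppoly def_n raddf_sum coef_sum big_ord_recr big1 => [|i _] /=; last first.
  rewrite linearZ coefZ /= partial_mono coef_dmon_ppow 1?ltnW //.
  by rewrite gtn_eqF // mulr0.
rewrite linearZ coefZ /= partial_mono coef_dmon_ppow // eqxx add0r.
apply/eqP; rewrite mulf_eq0 -[p`_n]/(p`_n.+1.-1) -def_n -lead_coefE lead_coef_eq0.
rewrite (negPf nzp) /=; case: ifP => _; first by rewrite oner_eq0.
by move: char2; rewrite inE /= => /negPf->.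
Qed.
End Injectivity.

(** * Induction and degree on monomials; reduction with integer coefficients *)

Lemma cmul_pi (s t : tree) :
  cmul (\pi_cmon s)%qT (\pi_cmon t)%qT = (\pi_cmon (Node s t))%qT.
Proof.
by apply/eqP; rewrite eqmodE /=; apply/orP; left; rewrite -!eqmodE !reprK !eqxx.
Qed.

Lemma cmon_ind (P : cmon -> Prop) :
  P cx -> (forall u v, P u -> P v -> P (cmul u v)) -> forall w, P w.
Proof.
move=> Px PM w; rewrite -[w]reprK.
by elim: (repr w) => [|a IHa b IHb]; rewrite -?cmul_pi; [apply: Px|apply: PM].
Qed.

Lemma cdeg_x : cdeg cx = 1%N.
Proof. exact: (cfold_x 1%N addnC). Qed.

Lemma cdegM u v : cdeg (cmul u v) = (cdeg u + cdeg v)%N.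
Proof. exact: (cfoldM 1%N addnC). Qed.

Lemma cdeg_gt0 u : (0 < cdeg u)%N.
Proof. by elim/cmon_ind: u => [|u v u0 v0]; rewrite ?cdeg_x ?cdegM ?addn_gt0 ?u0. Qed.

Lemma cdeg_ppow n : cdeg (ppow n.+1) = n.+1.
Proof. by elim: n => [|n IHn]; rewrite ?cdeg_x // ppowS // cdegM IHn cdeg_x. Qed.

Lemma cdeg_eq1 u : cdeg u = 1%N -> u = cx.
Proof.
elim/cmon_ind: u => // u v _ _; rewrite cdegM.
by have := cdeg_gt0 u; have := cdeg_gt0 v; lia.
Qed.

(* The exponents are shifted as in [ppoly]: the recursion is
   x^i x^j = x^(i+1) + x^(j+1) - x^2 modulo E. *)
Definition zred : cmon -> {poly int} := cfold 1 (fun p q => 'X * (p + q - 1)).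

Lemma zred_x : zred cx = 1.
Proof. by apply: cfold_x => p q; rewrite [p + q]addrC. Qed.

Lemma zredM u v : zred (cmul u v) = 'X * (zred u + zred v - 1).
Proof. by apply: cfoldM => p q; rewrite [p + q]addrC. Qed.

(** The recursion preserves this value because 1 + 1 - 1 = 1; it is the normalisation required by
    [in_ideal_kmul_ppoly]. *)
Lemma zred_at1 w : (zred w).[1] = 1.
Proof.
elim/cmon_ind: w => [|u v u1 v1]; first by rewrite zred_x hornerC.
by rewrite zredM !hornerE u1 v1 addrK.
Qed.

Lemma size_zredM u v :
  (size (zred (cmul u v)) <= (maxn (size (zred u)) (size (zred v))).+1)%N.
Proof.
(* Nonzero reductions have size at least 1, so subtracting the constant 1 cannot exceed the maximum
   of the two sizes. *)
have sz w : (0 < size (zred w))%N.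
  rewrite size_poly_gt0; apply/eqP => w0.
  by have := zred_at1 w; rewrite w0 horner0.
rewrite zredM (leq_trans (size_polyMleq _ _)) // size_polyX add2n ltnS.
rewrite (leq_trans (size_polyD _ _)) // size_polyN size_poly1 geq_max.
by rewrite size_polyD leq_max sz.
Qed.

(* [size (zred w)] is at most one more than the depth of [w], which is maximal
   for principal powers only. *)
Lemma size_zred w :
  (size (zred w) <= cdeg w)%N /\ (w <> ppow (cdeg w) -> (size (zred w) < cdeg w)%N).
Proof.
elim/cmon_ind: w => [|u v [u1 u2] [v1 v2]].
  by rewrite zred_x cdeg_x size_poly1; split.
have := size_zredM u v; rewrite cdegM.
wlog uv : u v u1 u2 v1 v2 / (cdeg u <= cdeg v)%N => [W|].
  case: (leqP (cdeg u) (cdeg v)) => [|/ltnW] uv; first exact: W.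
  by rewrite maxnC addnC cmulC; apply: W.
(* If the smaller factor has degree at least 2, then 1 + [cdeg v] is already below the total degree.
   Otherwise u = x, and strictness is inherited from v. *)
have du := cdeg_gt0 u; have [/cdeg_eq1 eu|du1] := eqVneq (cdeg u) 1%N; last first.
  by split=> [|_]; lia.
rewrite eu cdeg_x zred_x size_poly1 in u1 uv *.
move=> szM; split=> [|nw]; first by rewrite (leq_trans szM) // ltnS geq_max uv.
(* The case v = x would give the principal power x^2, which [nw] excludes. *)
have cv2 : (1 < cdeg v)%N.
  rewrite ltn_neqAle uv andbT eq_sym; apply/eqP => /cdeg_eq1 ev.
  by apply: nw; rewrite ev cdeg_x.
rewrite (leq_ltn_trans szM) // add1n ltnS gtn_max cv2.
by apply: v2 => ev; apply: nw; rewrite {1}ev add1n ppowS ?cdeg_gt0.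
Qed.

(** * Reduction over a field *)

Section Reduction.
Variable K : fieldType.
Implicit Types (f g h : KX K) (p q : {poly K}).

(** Taking the image of one integral polynomial makes the reductions over Q and over K
    comparable. *)
Definition fred (w : cmon) : {poly K} := map_poly intr (zred w).

Lemma fredM u v : fred (cmul u v) = 'X * (fred u + fred v - 1).
Proof. by rewrite /fred zredM rmorphM rmorphB rmorphD /= map_polyX rmorph1. Qed.

Lemma fred_at1 w : (fred w).[1] = 1.
Proof. by rewrite -[in LHS](rmorph1 intr) horner_map /= zred_at1. Qed.

Lemma size_fred w : (size (fred w) <= size (zred w))%N.
Proof. exact: size_poly. Qed.

Lemma in_idealB f g : in_ideal f -> in_ideal g -> in_ideal (f - g).
Proof.
by move=> fE gE; apply: ideal_add => //; rewrite -scaleN1r; apply: ideal_scale.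
Qed.

Lemma in_ideal_mono_fred w : in_ideal (mono K w - ppoly (fred w)).
Proof.
elim/cmon_ind: w => [|u v uE vE].
  by rewrite /fred zred_x rmorph1 ppoly1 subrr; apply: ideal_zero.
(* The factors are replaced by their reductions one at a time: uv, then u P_v, then P_u P_v, and
   finally the reduction of this last product. *)
rewrite fredM -kmul_mono -(subrKA (kmul (ppoly (fred u)) (ppoly (fred v)))).
apply: ideal_add; last by apply: in_ideal_kmul_ppoly; apply: fred_at1.
rewrite -(subrKA (kmul (mono K u) (ppoly (fred v)))); apply: ideal_add.
  by rewrite -raddfB /=; apply: ideal_mull.
by rewrite ![kmul _ (ppoly (fred v))]kmulC -raddfB /=; apply: ideal_mull.
Qed.

Lemma in_ideal_fred f : in_ideal (f - ppoly (lext fred f)).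
Proof.
have -> : f - ppoly (lext fred f)
    = \sum_(m <- msupp f) f@_m *: (mono K m - ppoly (fred m)).
  rewrite -{1}(lext_id f) /lext (raddf_sum (@ppoly K)) -sumrB; apply: eq_bigr => m _ /=.
  by rewrite linearZ /= scalerBr.
exact: in_ideal_sum in_ideal_mono_fred.
Qed.

Lemma projE_eqP f g : projE f = projE g <-> in_ideal (f - g).
Proof.
rewrite /projE; split=> [/eqP|fg]; last apply/eqP; rewrite -Quotient.idealrBE.
  by move/asboolP.
exact/asboolP.
Qed.

Lemma principal_span_inj f g : 2%N \notin [pchar K] ->
  principal_span f -> principal_span g -> partial f = partial g -> f = g.
Proof.
move=> char2 /principal_spanP[p ->] /principal_spanP[q ->].
by move/(partial_ppoly_inj char2)->.
Qed.

Lemma evanescent_ideal f : f <> 0 -> in_ideal f -> evanescent f.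
Proof. by move=> f0 /partial_eval1_ideal[]. Qed.

(** * Homogeneous components and train polynomials *)

Definition hcomp (d : nat) f : KX K :=
  lext (fun m => if cdeg m == d then mono K m else 0) f.

Lemma mcoeff_hcomp d f m : (hcomp d f)@_m = if cdeg m == d then f@_m else 0.
Proof.
rewrite /hcomp /lext raddf_sum /=.
rewrite (eq_bigr (fun u => (if cdeg m == d then f@_u else 0) * (u == m)%:R)).
  case: (msuppP f m) => [fm|nfm]; last first.
    rewrite if_same big_seq big1 // => u fu; have [e|] := eqVneq u m; rewrite ?mulr0 //.
    by rewrite -e fu in nfm.
  rewrite (big_fsetD1 m) //= eqxx mulr1 big_seq big1 ?addr0 // => u.
  by rewrite in_fsetD1 => /andP[/negPf-> _]; rewrite mulr0.
move=> u _; rewrite mcoeffZ; have [->|um] := eqVneq u m.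
  by case: ifP; rewrite ?mcoeff0 ?mulr0 ?mul0r // mcoeffUU.
by case: ifP; rewrite ?mcoeff0 ?mulr0 ?mul0r // mcoeffU (negPf um) mulr0n ?mulr0.
Qed.

Lemma homog_hcomp d f : homog d (hcomp d f).
Proof.
apply/allP => m; rewrite -mcoeff_neq0 mcoeff_hcomp.
by rewrite /=; case: ifP; rewrite ?eqxx.
Qed.

Lemma homogN d f : homog d (- f) = homog d f.
Proof. by rewrite /homog msuppN. Qed.

Lemma cdeg_le_kdeg f m : m \in msupp f -> (cdeg m <= kdeg f)%N.
Proof. by move=> fm; rewrite /kdeg (big_fsetD1 m) //= leq_maxl. Qed.

Lemma kdeg_leP f d : (forall m, f@_m != 0 -> (cdeg m <= d)%N) -> (kdeg f <= d)%N.
Proof.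
move=> fd; rewrite /kdeg big_seq.
apply: (big_ind (fun x => x <= d)%N) => // [x y xd yd|m].
  by rewrite geq_max xd.
by rewrite -mcoeff_neq0; apply: fd.
Qed.

Lemma hcomp_sum f : f = \sum_(d < (kdeg f).+1) hcomp d f.
Proof.
apply/malgP => m; rewrite raddf_sum /=.
case: (msuppP f m) => [fm|nfm]; last first.
  rewrite big1 // => d _; rewrite mcoeff_hcomp (mcoeff_outdom nfm).
  exact: if_same.
pose d0 := Ordinal (cdeg_le_kdeg fm : cdeg m < (kdeg f).+1)%N.
rewrite (bigD1 d0) //= mcoeff_hcomp eqxx big1 ?addr0 // => d.
rewrite mcoeff_hcomp; have [e /eqP[]|] := eqVneq (cdeg m) d; last by [].
by apply: val_inj; rewrite /= e.
Qed.

(** Otherwise f would be the sum of its components of smaller degree, against the maximality in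
    [kdeg]. *)
Lemma hcomp_kdeg_neq0 f : f <> 0 -> hcomp (kdeg f) f <> 0.
Proof.
move=> f0 h0; apply: f0; have := hcomp_sum f; rewrite big_ord_recr /= h0 addr0.
case def_d: (kdeg f) => [|d]; first by rewrite big_ord0.
move=> ef; suff : (kdeg f <= d)%N by rewrite def_d ltnn.
apply: kdeg_leP => m; rewrite leqNgt; apply: contraNN => dm.
rewrite ef raddf_sum big1 //= => i _; rewrite mcoeff_hcomp; case: eqP => // e.
by have := ltn_ord i; rewrite -e ltnS leqNgt dm.
Qed.

Lemma train_poly_kdeg f :
  ~ homogeneous f -> eval1 f = 0 -> train_poly (kdeg f) f.
Proof.
move=> nhf f1; split=> //; set n := kdeg f.
(* Degrees of the nonzero lower components, in increasing order: zero components are not allowed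
   among the h_i. *)
pose s := [seq d <- iota 0 n | hcomp d f != 0].
have s_mem (i : 'I_(size s)) : (hcomp (nth 0%N s i) f != 0) && ((nth 0%N s i) < n)%N.
  by have := mem_nth 0%N (ltn_ord i); rewrite mem_filter mem_iota.
exists (hcomp n f), (size s),
  (fun i => - hcomp (nth 0%N s i) f), (nth 0%N s).
split=> [||i|i j ij|i].
- rewrite sumrN opprK {1}(hcomp_sum f) big_ord_recr /= addrC; congr (_ + _).
  rewrite -(big_mkord xpredT (fun d => hcomp d f)) /index_iota subn0.
  rewrite (bigID (fun d => hcomp d f == 0)) /= big1 => [|d /eqP //]; rewrite add0r.
  by rewrite -big_filter -/s (big_nth 0%N) big_mkord.
- split; last exact: homog_hcomp.
  apply: hcomp_kdeg_neq0 => f0; apply: nhf; exists 0%N.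
  by rewrite /homog f0 msupp0.
- have /andP[/eqP h0 _] := s_mem i; split; last by rewrite homogN homog_hcomp.
  by move/eqP; rewrite oppr_eq0 => /eqP.
- have: sorted ltn s by apply: sorted_filter (iota_ltn_sorted _ _); apply: ltn_trans.
  by move/(sorted_ltn_nth ltn_trans 0%N); apply; rewrite ?inE.
by have /andP[] := s_mem i.
Qed.

(** Zero counts as homogeneous, so non-homogeneity also provides f <> 0. *)
Lemma evanescent_train_ideal f :
  ~ homogeneous f -> in_ideal f -> evanescent_train f.
Proof.
move=> nhf fE; have [_ f1] := partial_eval1_ideal fE.
split; first by exists (kdeg f); apply: train_poly_kdeg.
apply: evanescent_ideal => // f0; apply: nhf; exists 0%N.
by rewrite /homog f0 msupp0.
Qed.

Lemma mcoeff_ppoly p m :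
  (ppoly p)@_m = \sum_(i < size p) p`_i * (ppow i.+1 == m)%:R.
Proof.
by rewrite raddf_sum; apply: eq_bigr => i _ /=; rewrite mcoeffZ mcoeffU.
Qed.

Lemma kdeg_ppoly p : (kdeg (ppoly p) <= size p)%N.
Proof.
apply: kdeg_leP => m; apply: contraR; rewrite -ltnNge => pm.
rewrite mcoeff_ppoly big1 // => i _; case: eqVneq => [e|]; rewrite ?mulr0 //.
by move: pm; rewrite -e cdeg_ppow ltnNge ltn_ord.
Qed.

Lemma train_reduct_fred w : 2%N \notin [pchar K] -> w <> ppow (cdeg w) ->
  unique (@train_reduct K (cdeg w) w) (ppoly (fred w)).
Proof.
move=> char2 nw.
have ltP : (kdeg (ppoly (fred w)) < cdeg w)%N.
  rewrite (leq_ltn_trans (kdeg_ppoly _)) // (leq_ltn_trans (size_fred _)) //.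
  by have [_] := size_zred w; apply.
(* Uniqueness: [partial] takes the same value on any other reduct Q, on w and on the reduction of
   w. *)
split=> [|Q [Q1 _ [_ [_ Q2 _]]]]; last first.
  apply: principal_span_inj => //; first by apply/principal_spanP; exists (fred w).
  have [eP _] := partial_eval1_ideal (in_ideal_mono_fred w).
  transitivity (partial (mono K w)); [apply/esym|]; apply: subr0_eq.
    by rewrite -raddfB.
  by rewrite -raddfB.
split=> //; first by apply/principal_spanP; exists (fred w).
apply: evanescent_train_ideal; last exact: in_ideal_mono_fred.
(* Non-homogeneity: w survives in F and forces d = [cdeg w], while the reduction lives in lower
   degrees. It would then be zero, although its value at 1 is 1. *)
case=> d; set F := _ - _ => homF.
have Fd m : F@_m != 0 -> cdeg m = d.
  by rewrite mcoeff_neq0 => Fm; apply/eqP; apply: (allP homF).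
have lowF m : (cdeg m < cdeg w)%N -> F@_m = - (ppoly (fred w))@_m.
  move=> mw; rewrite mcoeffB mcoeffU; case: eqP mw => [->|]; first by rewrite ltnn.
  by rewrite sub0r.
have ew : cdeg w = d.
  apply: Fd; rewrite mcoeffB mcoeffUU mcoeff_outdom ?subr0 ?oner_neq0 //.
  by apply/negP => /cdeg_le_kdeg; rewrite leqNgt ltP.
have P0 : ppoly (fred w) = 0.
  apply/malgP => m; rewrite mcoeff0; apply/eqP/negPn/negP => Pm.
  have mw : (cdeg m < cdeg w)%N.
    by apply: leq_ltn_trans ltP; apply: cdeg_le_kdeg; rewrite -mcoeff_neq0.
  by have := Fd m; rewrite lowF // oppr_eq0 => /(_ Pm) em; rewrite em ew ltnn in mw.
have := fred_at1 w; rewrite -eval1_ppoly P0 raddf0 => /eqP.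
by rewrite eq_sym oner_eq0.
Qed.
End Reduction.

(** * Change of coefficients from Q to K *)

Lemma mcoeff_ppoly_intr (K : fieldType) (z : {poly int}) m :
  (ppoly (map_poly intr z : {poly K}))@_m
    = (\sum_(i < size z) z`_i * (ppow i.+1 == m)%:R)%:~R.
Proof.
rewrite (@ppolyEw _ (size z)) ?size_poly // raddf_sum rmorph_sum /=.
apply: eq_bigr => i _; rewrite mcoeffZ mcoeffU coef_map rmorphM /=.
by rewrite rmorph_nat.
Qed.

Lemma base_change_fred (K : fieldType) w :
  base_change K (ppoly (fred rat w)) = ppoly (fred K w).
Proof.
apply/malgP => m; rewrite /fred mcoeff_ppoly_intr.
set P := ppoly _; have Pz u := mcoeff_ppoly_intr rat (zred w) u.
rewrite /base_change raddf_sum /= (eq_bigr (fun u => ratr P@_u *+ (u == m))); last first.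
  by move=> u _; rewrite mcoeffU.
case: (msuppP P m) => [Pm|nPm].
  rewrite (big_fsetD1 m) //= eqxx big_seq big1 ?addr0 => [|u].
    by rewrite Pz ratr_int.
  by rewrite in_fsetD1 => /andP[/negPf-> _].
rewrite big_seq big1 => [|u Pu]; last first.
  by case: eqVneq => // e; rewrite -e Pu in nPm.
(* A coefficient that vanishes in Q comes from the integer 0, by characteristic zero, so it vanishes
   in K too. *)
have := mcoeff_outdom nPm; rewrite Pz => /eqP; rewrite intr_eq0 => /eqP->.
by rewrite rmorph0.
Qed.

Theorem mainTheorem4 (K : fieldType) (charK : 2%N \notin [pchar K]) :
  (forall (n : nat) (w : cmon),
     (4 <= n)%N -> cdeg w = n -> w <> ppow n -> card_units_gt K n ->
     exists P : KX rat,
       [/\ unique (@train_reduct rat n w) P,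
           forall m : cmon, P@_m \is a Num.int,
           unique (@train_reduct K n w) (base_change K P) &
           projE (mono K w) = projE (base_change K P)])
  /\
  (forall f : KX K,
     (4 <= kdeg f)%N -> card_units_gt K (kdeg f) ->
     exists r : KX K,
       [/\ unique (reduces_to f) r,
           ~ principal_span f -> evanescent (f - r) &
           ~ homogeneous (f - r) -> evanescent_train (f - r)]).
Proof.
split=> [n w _ <- nw _|f _ _].
  exists (ppoly (fred rat w)); rewrite base_change_fred.
  split; [|move=> m| |].
  - by apply: train_reduct_fred => //; rewrite pchar_num.
  - by rewrite mcoeff_ppoly_intr intr_int.
  - exact: train_reduct_fred.
  exact/projE_eqP/in_ideal_mono_fred.
(* The class of f is obtained by extending the reduction of monomials linearly. *)
pose r := ppoly (lext (fred K) f); exists r.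
have rP : principal_span r by apply/principal_spanP; exists (lext (fred K) f).
have frE : in_ideal (f - r) := in_ideal_fred f.
split=> [|nf|nh]; last exact: evanescent_train_ideal.
  split=> [|q [qP /projE_eqP fqE]]; first by split=> //; apply/projE_eqP.
  apply: principal_span_inj => //; apply/eqP; rewrite -subr_eq0 -raddfB /=.
  (* Two reductions of f differ by an element of the ideal, which [partial] kills; injectivity on
     the span identifies them. *)
  have -> : r - q = (f - q) - (f - r) by rewrite opprB [RHS]addrC subrKA.
  by have [-> _] := partial_eval1_ideal (in_idealB fqE frE).
apply: evanescent_ideal => // /eqP; rewrite subr_eq0 => /eqP fr.
by apply: nf; rewrite fr.
Qed.
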